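(* $$\sum_{\pi\in\mathcal{G}_O^{N}}q^{|\pi|}=\sum_{m\geq1}\frac{1}{(q;q)_m} \sum_{k=0}^{m-1}q^{(k+1)m-\binom{k+1}{2}} .$$
   Context: An overpartition is a finite non-increasing sequence of positive integers (its parts) in which the first occurrence of each number may be overlined (so for each size $t$ at most one part of size $t$ is overlined); the size of a part $t$ or $\overline{t}$ is $t$, and the weight $|\pi|$ is the sum of the sizes of the parts. $\mathcal{G}_O^{N}$ is the set of overpartitions in which at least one non-overlined part appears and the sizes of all non-overlined parts are greater than the sizes of all overlined parts (if any). Here $|q|<1$ (or $q$ is a formal variable), $(q;q)_m=\prod_{i=1}^{m}(1-q^i)$. *)

(* Defs.v *)
Set Warnings "-all".
From HB Require Import structures.
From mathcomp Require Import all_boot all_order all_algebra finmap.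
From mathcomp Require Import all_classical all_reals topology normedtype sequences.
From mathcomp Require Import summability.
From mathcomp Require Import complex.
Set Implicit Arguments.
Unset Strict Implicit.
Unset Printing Implicit Defensive.
Import Order.TTheory GRing.Theory Num.Theory.
Import numFieldNormedType.Exports.
Local Open Scope nat_scope.

(* The pair (t, b) stands for the part t if b = false, and for the overlined
   part of size t if b = true. *)
Definition part : Type := (nat * bool)%type.
HB.instance Definition _ := Countable.on part.

Definition psize (p : part) : nat := p.1.
Definition overlined (p : part) : bool := p.2.

Definition is_overpartition (s : seq part) : bool :=
  [&& all (fun p => 0 < psize p) s,
      sorted geq (map psize s)
    & [forall i : 'I_(size s),
        let p := tnth (in_tuple s) i in
        overlined p ==> (psize p \notin map psize (take i s))]].

Record overpartition := Overpartition {
  parts :> seq part;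
  _ : is_overpartition parts }.

HB.instance Definition _ := [isSub for parts].
HB.instance Definition _ := [Countable of overpartition by <:].

Definition weight (pi : overpartition) : nat := \sum_(p <- pi) psize p.

(* Membership in G_O^N. *)
Definition GON (pi : overpartition) : bool :=
  has (fun p => ~~ overlined p) pi &&
  all (fun p => all (fun p' => ~~ overlined p ==> overlined p' ==>
                               (psize p' < psize p)) pi) pi.

Local Open Scope ring_scope.

(* The q-shifted factorial (q; q)_m. *)
Definition qpoch (K : fieldType) (q : K) (m : nat) : K :=
  \prod_(1 <= i < m.+1) (1 - q ^+ i).

(* The complex numbers over R. The expected type selects the topology induced
   by the modulus, which is not inferred for R[i] itself. *)
Definition Cplx (R : realType) : numClosedFieldType := R[i].

(* Main.v *)
Require Import Defs.
Set Warnings "-all".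
From HB Require Import structures.
From mathcomp Require Import all_boot all_order all_algebra finmap.
From mathcomp Require Import all_classical all_reals topology normedtype sequences.
From mathcomp Require Import summability complex exp.
From mathcomp Require Import zify ring lra.
Import Order.TTheory GRing.Theory Num.Theory.
Import numFieldNormedType.Exports.
Set Implicit Arguments.
Unset Strict Implicit.
Unset Printing Implicit Defensive.

(** A member of G_O^N with m parts, k < m of them overlined, consists of m - k
    non-overlined parts followed by k strictly smaller, pairwise distinct
    overlined parts. Going up from the smallest part, the size must increase by
    at least 1 at the first k + 1 steps, and these forced increases contribute
    (k + 1) m - binom(k + 1, 2) to the weight; the remaining increases d_i are
    arbitrary and contribute the sum of (i + 1) d_i over i < m, hence the factor
    1 / (q; q)_m.
    For the analytic identity, the members with m < M and all d_i < N form
    finite boxes exhausting G_O^N. Over a box the sum factors into finite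
    geometric sums, and it tends to the M-th partial sum of the right-hand side
    as N grows. Unconditional convergence follows from a uniform bound on the
    box sums at |q|, obtained from 1 / (r; r)_m <= exp (1 / (1 - r)^2). *)

(** * Decoding increments into members of G_O^N *)

Local Open Scope nat_scope.

(* The difference between the sizes of the parts at positions i and i + 1 (a
   part of size 0 follows the last one); position m - k is the first overlined
   one, so the forced increases are at the last k + 1 positions. *)
Definition gap m k (d : nat -> nat) i := d i + (m <= i + k.+1).
Definition dsize m k d p := \sum_(p <= i < m) gap m k d i.
Definition decode m k d : seq part :=
  mkseq (fun p => (dsize m k d p, m <= p + k)) m.

Lemma dsizeE m k d p : p < m -> dsize m k d p = gap m k d p + dsize m k d p.+1.
Proof. by move=> pm; rewrite /dsize big_ltn. Qed.

Lemma leq_dsize m k d p p' : p <= p' -> dsize m k d p' <= dsize m k d p.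
Proof.
move=> pp; have [mp|mp] := leqP m p'; first by rewrite /dsize (big_geq mp).
by rewrite {2}/dsize (@big_cat_nat _ _ _ p') ?leq_addl //= ltnW.
Qed.

(** The step just before [p'] carries a forced increase of 1. Since [p' = m] is allowed, where the
    size is 0, positivity of all parts follows too. *)
Lemma ltn_dsize m k d p p' : p < p' -> p' <= m -> m <= p' + k ->
  dsize m k d p' < dsize m k d p.
Proof.
case: p' => // p' pp pm mk; apply: (@leq_trans (dsize m k d p')); last first.
  by apply: leq_dsize.
rewrite (dsizeE k d pm) /gap; have -> : m <= p' + k.+1 by rewrite addnS -addSn.
by rewrite addn1 addSn ltnS leq_addl.
Qed.

Lemma map_psize_decode m k d : map psize (decode m k d) = mkseq (dsize m k d) m.
Proof. by rewrite /decode /mkseq -map_comp. Qed.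

Lemma decode_overpartition m k d : is_overpartition (decode m k d).
Proof.
apply/and3P; split.
- apply/allP => _ /mapP[p + ->]; rewrite mem_iota add0n /psize /= => pm.
  have := @ltn_dsize m k d p m pm (leqnn _) (leq_addr _ _).
  by rewrite {1}/dsize big_geq.
- rewrite map_psize_decode; apply/(sortedP 0) => i; rewrite size_mkseq => im.
  by rewrite !nth_mkseq // 1?ltnW //; apply: leq_dsize.
- apply/forallP => -[i /= im]; have im' := im; rewrite size_mkseq in im'.
  rewrite (tnth_nth (0, false)) /= nth_mkseq //; apply/implyP => /= mk.
  rewrite map_take map_psize_decode; apply/negP => /(nthP 0) [j].
  rewrite size_take size_mkseq im' => ji.
  rewrite nth_take // nth_mkseq ?(ltn_trans ji) // => E.
  by have := @ltn_dsize m k d j i ji (ltnW im') mk; rewrite E ltnn.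
Qed.

Definition decode_op m k d := Overpartition (decode_overpartition m k d).

Lemma decode_GON m k d : k < m -> GON (decode_op m k d).
Proof.
move=> km; apply/andP; split.
  apply/hasP; exists (dsize m k d 0, m <= 0 + k); last by rewrite /overlined /= -ltnNge.
  by apply/mapP; exists 0; rewrite // mem_iota /=; lia.
apply/allP => _ /mapP[p + ->]; rewrite mem_iota add0n => /= pm.
apply/allP => _ /mapP[p' + ->]; rewrite mem_iota add0n => /= pm'.
rewrite /overlined /psize /=; apply/implyP => h1; apply/implyP => h2.
by apply: ltn_dsize => //; lia.
Qed.

(** * The weight of a decoded overpartition *)

Lemma leq_bin2 m k : k < m -> 'C(k.+1, 2) <= k * m.
Proof.
move=> km; rewrite bin2 /=; apply: (@leq_trans (k.+1 * k)); first by lia.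
by rewrite mulnC leq_mul2l; lia.
Qed.

(** The left side is m + (m - 1) + ... + (m - k). Raising [k] by one adds a forced increase at
    position [m - k.+2], worth [m - k.+1]. *)
Lemma min_weight m k : k < m ->
  \sum_(0 <= i < m) i.+1 * (m <= i + k.+1) = k.+1 * m - 'C(k.+1, 2).
Proof.
elim: k => [|k IH] km.
  rewrite -(prednK km) big_nat_recr //= bin_small // subn0 mul1n.
  rewrite big_nat big1 ?add0n; first by lia.
  by move=> i /andP[_ im]; rewrite addn1 ltnS leqNgt im muln0.
have := IH (ltnW km) => {}IH.
have -> : \sum_(0 <= i < m) i.+1 * (m <= i + k.+2) =
   \sum_(0 <= i < m) i.+1 * (m <= i + k.+1) + \sum_(0 <= i < m) i.+1 * (i + k.+2 == m).
  rewrite -big_split /=; apply: eq_big_nat => i im.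
  by rewrite -mulnDr; congr (_ * _); lia.
rewrite IH.
have -> : \sum_(0 <= i < m) i.+1 * (i + k.+2 == m) = m - k.+1.
  rewrite (bigD1_seq (m - k.+2)) ?mem_index_iota ?iota_uniq //=; last by lia.
  rewrite big1_seq /=; last by move=> i /andP[ni _]; lia.
  by lia.
have -> : 'C(k.+2, 2) = 'C(k.+1, 2) + k.+1 by rewrite binS bin1.
by have := leq_bin2 (ltnW km); rewrite mulSn [k.+2 * m]mulSn; lia.
Qed.

(** Summation by parts: the gap at [i] enters the sizes at positions 0 to [i], hence is counted
    [i.+1] times. The boundary term makes the induction on [n] work and vanishes at [n = m]. *)
Lemma sum_dsize m k d n : n <= m ->
  \sum_(0 <= p < n) dsize m k d p =
  \sum_(0 <= i < n) i.+1 * gap m k d i + n * dsize m k d n.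
Proof.
elim: n => [|n IH] nm; first by rewrite !big_geq.
by rewrite !big_nat_recr //= IH ?(ltnW nm) // (dsizeE _ _ nm); lia.
Qed.

Lemma weight_decode m k d : k < m ->
  weight (decode_op m k d) =
  (k.+1 * m - 'C(k.+1, 2)) + \sum_(i < m) i.+1 * d i.
Proof.
move=> km; rewrite /weight /= /decode /mkseq big_map /psize /=.
have -> : iota 0 m = index_iota 0 m by rewrite /index_iota subn0.
rewrite sum_dsize // [dsize m k d m]big_geq // muln0 addn0 -min_weight // -(big_mkord xpredT (fun i => i.+1 * d i)).
by rewrite -big_split; apply: eq_bigr => i _; rewrite /gap mulnDr addnC.
Qed.

Lemma size_decode m k d : size (decode m k d) = m.
Proof. exact: size_mkseq. Qed.

(** * Decoding is a bijection onto G_O^N *)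

Lemma decode_inj m k d k' d' : k < m -> k' < m ->
  decode m k d = decode m k' d' -> k = k' /\ {in gtn m, d =1 d'}.
Proof.
move=> km km' E.
have F p : p < m -> dsize m k d p = dsize m k' d' p /\ (m <= p + k) = (m <= p + k').
  move=> pm; have := congr1 (fun s => nth (0, false) s p) E.
  by rewrite /decode !nth_mkseq // => -[-> ->].
have kk : k = k'.
  (* If [k < k'], the overline flags at position [m - k'] disagree; symmetrically otherwise. *)
  have := F (m - k - 1); have := F (m - k' - 1); have := F (m-k); have := F (m - k').
  have : 0 < m by lia.
  by case: (ltngtP k k') => //; lia.
split=> // p; rewrite inE => pm; subst k'.
have := dsizeE k d pm; have := dsizeE k d' pm; have [-> _] := F _ pm => ->.
have -> : dsize m k d p.+1 = dsize m k d' p.+1.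
  have [pm'|pm'] := ltnP p.+1 m; first by case: (F _ pm').
  by rewrite /dsize !big_geq.
by rewrite /gap; lia.
Qed.

Lemma path_implb_all (s : seq bool) :
  path (fun a b : bool => a ==> b) true s -> all id s.
Proof. by elim: s => //= -[] s IH. Qed.

(** Sorted by implication means that every [false] precedes every [true], so the [true] entries fill
    a suffix whose length is their number. *)
Lemma nth_sorted_bool (s : seq bool) : sorted (fun a b : bool => a ==> b) s ->
  forall p, p < size s -> nth false s p = (size s <= p + count id s).
Proof.
elim: s => [//|b s IH] /= bs p ps.
have ss := path_sorted bs.
case: p ps => [|p] ps /=.
  case: b bs => /= bs; last by have := count_size id s; lia.
  rewrite add0n add1n ltnS; apply/esym.
  suff : all id s by rewrite all_count => /eqP ->; rewrite leqnn.
  exact: path_implb_all.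
rewrite IH // addSn ltnS; case: b bs {IH} => //= bs.
suff : all id s by rewrite all_count => /eqP ->; lia.
exact: path_implb_all.
Qed.

Lemma GON_decode (pi : overpartition) : GON pi ->
  exists k d, k < size pi /\ val pi = decode (size pi) k d.
Proof.
case: pi => s sP /= /andP[/= sN /allP sA].
case/and3P: (sP) => /allP s0 ss /forallP so.
set z : part := (0, false); set m := size s.
pose t p := psize (nth z s p).
have t_ge i j : i <= j -> t j <= t i.
  move=> ij; have [jm|jm] := ltnP j m; last by rewrite /t nth_default.
  rewrite /t -!(nth_map z 0) ?(leq_ltn_trans ij) //.
  have gt : transitive geq by move=> a b c /= ab bc; apply: leq_trans bc ab.
  by apply: (sorted_leq_nth gt (fun x => leqnn x) 0 ss) => //;
    rewrite inE size_map // (leq_ltn_trans ij).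
have tm p : m <= p -> t p = 0 by move=> mp; rewrite /t nth_default.
have t0 p : p < m -> 0 < t p by move=> pm; apply: s0; apply: mem_nth.
pose k := count overlined s.
have km : k < m.
  rewrite /k /m -(count_predC overlined s) -[ltnLHS]addn0 ltn_add2l -has_count.
  exact: sN.
have flagE p : p < m -> overlined (nth z s p) = (m <= p + k).
  move=> pm; rewrite -(nth_map z false) // nth_sorted_bool ?size_map ?count_map //.
  (* An overlined part directly followed by a non-overlined one would be strictly smaller than it,
     against the non-increasing order. *)
  apply/(sortedP false) => i; rewrite size_map => im.
  rewrite !(nth_map z) // 1?ltnW //; apply/implyP => oi; apply/negPn/negP => oi'.
  have := sA _ (mem_nth z im) => /allP /(_ _ (mem_nth z (ltnW im))).
  rewrite oi oi' /= => h.
  by have := t_ge i i.+1 (leqnSn _); rewrite /t leqNgt h.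
(* The part at [p.+1] is overlined, hence the first of its size, so the preceding size differs. *)
have t_gt p : p.+1 < m -> m <= p.+1 + k -> t p.+1 < t p.
  move=> pm mk; rewrite ltn_neqAle t_ge // andbT.
  have := so (Ordinal pm); rewrite (tnth_nth z) /= flagE // mk /= => /negP h.
  apply/negP => /eqP E; apply: h; rewrite -/(t p.+1) E.
  apply: map_f; rewrite -(nth_take z (ltnSn p)); apply: mem_nth.
  by rewrite size_take pm.
(* For [p < m] both truncated subtractions are exact: sizes never increase, and they drop by at
   least 1 wherever an increase is forced. *)
pose d p := t p - t p.+1 - (m <= p + k.+1).
exists k, d; split=> //.
have gapE p : p < m -> gap m k d p = t p - t p.+1.
  (* At the last position the forced drop is the positivity of the last part; before it, it is
     [t_gt]. *)
  move=> pm; rewrite /gap /d subnK //; have [pm'|pm'] := ltnP p.+1 m; last first.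
    by rewrite (tm _ pm') subn0; have := t0 p pm; lia.
  case mk: (m <= p + k.+1) => //=; rewrite subn_gt0; apply: t_gt => //.
  by rewrite addSnnS.
have tE p : p <= m -> t p = dsize m k d p.
  move=> pm; rewrite -(subKn pm); elim: (m - p) (leq_subr p m) => [|j IH] jm.
    by rewrite subn0 tm // /dsize big_geq.
  have h : m - j.+1 < m by lia.
  rewrite dsizeE // gapE //; have -> : (m - j.+1).+1 = m - j by lia.
  rewrite -IH 1?ltnW // subnK //; apply: t_ge; lia.
apply: (@eq_from_nth _ z); first by rewrite size_decode.
move=> p pm; rewrite nth_mkseq // -tE ?(ltnW pm) // -flagE // /t.
by case: (nth z s p).
Qed.

Lemma eq_decode m k d d' : {in gtn m, d =1 d'} -> decode m k d = decode m k d'.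
Proof.
move=> dd; apply/eq_map => p; congr (_, _); apply: eq_big_nat => i /andP[_ im].
by rewrite /gap dd.
Qed.

(** * Finite boxes exhausting G_O^N and their generating functions *)

Local Open Scope classical_set_scope.
Local Open Scope ring_scope.

(** The default 0 is harmless: [decode m] reads only indices below [m]. *)
Definition ffun_nat m N (f : {ffun 'I_m -> 'I_N}) (i : nat) : nat :=
  oapp (fun j => nat_of_ord (f j)) 0%N (insub i).

Definition box_elt m N (x : 'I_m * {ffun 'I_m -> 'I_N}) :
    {p : overpartition | GON p} :=
  exist _ (decode_op m x.1 (ffun_nat x.2)) (decode_GON _ (ltn_ord x.1)).

Definition box M N : seq {p : overpartition | GON p} :=
  [seq box_elt x | m <- index_iota 1 M, x <- enum [set: 'I_m * {ffun 'I_m -> 'I_N}]%SET].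

Lemma ffun_nat_ord m N (f : {ffun 'I_m -> 'I_N}) (i : 'I_m) : ffun_nat f i = f i.
Proof. by rewrite /ffun_nat valK. Qed.

Lemma box_elt_inj m N : injective (@box_elt m N).
Proof.
move=> [k f] [k' f'] /(congr1 (fun p => parts (val p))) /= E.
have [/val_inj -> H] := decode_inj (ltn_ord _) (ltn_ord _) E.
by congr pair; apply/ffunP => i; apply: val_inj; have := H i (ltn_ord i); rewrite !ffun_nat_ord.
Qed.

Lemma box_uniq M N : uniq (box M N).
Proof.
apply: allpairs_uniq_dep => [|m _|]; [exact: iota_uniq|exact: enum_uniq|].
move=> [m x] [m' x'] _ _ /= E.
have mm : m = m'.
  have := congr1 (fun p => size (parts (val p))) E.
  by rewrite /= !size_decode.
by subst m'; rewrite (box_elt_inj E).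
Qed.

Lemma GON_box (p : {p : overpartition | GON p}) : exists M N, forall M' N',
  (M <= M')%N -> (N <= N')%N -> p \in box M' N'.
Proof.
case: p => p pG; have [k [d [kp E]]] := GON_decode pG.
(* The sum of all [(d i).+1] is a crude strict upper bound for every increment. *)
set m := size p in kp E; exists m.+1, (\sum_(i < m) (d i).+1)%N => M' N' mM dN.
have dlt (i : 'I_m) : (d i < N')%N.
  apply: leq_trans dN; rewrite (bigD1 i) //=; exact: leq_addr.
apply/allpairsPdep.
exists m, (Ordinal kp, [ffun i => Ordinal (dlt i)]); split.
- by rewrite mem_index_iota mM (leq_ltn_trans _ kp).
- by rewrite mem_enum inE.
- apply: val_inj; apply: val_inj; rewrite /= E; apply: eq_decode => i im.
  by rewrite (ffun_nat_ord _ (Ordinal im)) ffunE.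
Qed.

Definition boxset M N : {fset {p : overpartition | GON p}} :=
  seq_fset tt (box M N).

Lemma mem_box M N p : (p \in boxset M N) = (p \in box M N).
Proof. exact: seq_fsetE. Qed.

Lemma enum_box M N : perm_eq (boxset M N) (box M N).
Proof.
by rewrite (perm_trans (seq_fset_perm _ _)) // undup_id // box_uniq.
Qed.

Lemma seq_box (s : seq {p : overpartition | GON p}) : exists M N, forall M' N',
  (M <= M')%N -> (N <= N')%N -> {subset s <= box M' N'}.
Proof.
elim: s => [|p s [M [N sB]]]; first by exists 0%N, 0%N.
have [M1 [N1 pB]] := GON_box p.
exists (maxn M M1), (maxn N N1) => M' N'; rewrite !geq_max.
move=> /andP[m1 m2] /andP[n1 n2] x; rewrite inE => /orP[/eqP ->|]; first exact: pB.
by apply: sB.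
Qed.

(** The weight is additive in the increments, so distributivity turns the sum over increment
    functions into a product of finite geometric sums. *)
Lemma sum_box (K : comNzRingType) (q : K) M N :
  \sum_(p <- box M N) q ^+ weight (val p) =
  \sum_(1 <= m < M) (\prod_(i < m) \sum_(j < N) (q ^+ i.+1) ^+ j) *
     \sum_(0 <= k < m) q ^+ (k.+1 * m - 'C(k.+1, 2)).
Proof.
rewrite big_allpairs_dep; apply: eq_bigr => m _.
rewrite big_enum /= (eq_bigl xpredT) => [|x]; last by rewrite inE.
rewrite (eq_bigr (fun x : 'I_m * {ffun 'I_m -> 'I_N} =>
   q ^+ (x.1.+1 * m - 'C(x.1.+1, 2)) * \prod_(i < m) (q ^+ i.+1) ^+ x.2 i)).
  rewrite -(pair_big xpredT xpredT (fun (k : 'I_m) (f : {ffun 'I_m -> 'I_N}) =>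
    q ^+ (k.+1 * m - 'C(k.+1, 2)) * \prod_(i < m) (q ^+ i.+1) ^+ f i)) /=.
  rewrite big_mkord bigA_distr_bigA mulrC big_distrlr /=; apply: eq_bigr => k _.
  by [].
move=> [k f] _ /=; rewrite weight_decode // exprD; congr (_ * _).
rewrite -prodrXr; apply: eq_bigr => i _.
by rewrite ffun_nat_ord exprM.
Qed.

Definition term (K : fieldType) (q : K) (m : nat) : K :=
  (qpoch q m)^-1 * \sum_(0 <= k < m) q ^+ (k.+1 * m - 'C(k.+1, 2)).

Lemma qpochE (K : fieldType) (q : K) m : qpoch q m = \prod_(i < m) (1 - q ^+ i.+1).
Proof. by rewrite /qpoch big_add1 big_mkord. Qed.

(** Used to bound the inner sum of [term r m] by [m%:R * r ^+ m]. *)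
Lemma leq_exponent m k : (k < m)%N -> (m <= k.+1 * m - 'C(k.+1, 2))%N.
Proof.
by move=> km; have := leq_bin2 km; rewrite mulSn; lia.
Qed.

Lemma sum_geo (K : fieldType) (x : K) N : x != 1 ->
  \sum_(j < N) x ^+ j = (1 - x ^+ N) / (1 - x).
Proof.
move=> x1; have x1' : 1 - x != 0 by rewrite subr_eq0 eq_sym.
apply: (mulIf x1'); rewrite divfK // -{2}(expr1n _ N) subrXX mulrC.
by congr (_ * _); apply: eq_bigr => i _; rewrite expr1n mul1r.
Qed.

Lemma big_fsetDsub (V : nmodType) (I : choiceType) (A B : {fset I}) (F : I -> V) :
  (A `<=` B)%fset ->
  \sum_(i <- B) F i = \sum_(i <- A) F i + \sum_(i <- [fset x in B | x \notin A]%fset) F i.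
Proof.
move=> AB; rewrite (big_fsetID _ (mem A) B) /=; congr (_ + _).
have -> // : [fset x in B | x \in A]%fset = A.
apply/fsetP => x; rewrite !inE /= andbC; case: (boolP (x \in A)) => //= xA.
by rewrite (fsubsetP AB).
Qed.

Lemma ler_sum_fset (R : numDomainType) (I : choiceType) (A B : {fset I}) (F : I -> R) :
  (A `<=` B)%fset -> (forall i, 0 <= F i) ->
  \sum_(i <- A) F i <= \sum_(i <- B) F i.
Proof. by move=> AB F0; rewrite (big_fsetDsub F AB) lerDl sumr_ge0. Qed.

(** * Uniform bounds for a real base 0 <= r < 1 *)

Section Real.
Context (R : realType) (r : R) (r0 : 0 <= r) (r1 : r < 1).

Lemma expr_lt1n i : r ^+ i.+1 < 1.
Proof. by rewrite exprn_ilt1. Qed.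

Lemma qpoch_gt0 m : 0 < qpoch r m.
Proof. by rewrite qpochE; apply: prodr_gt0 => i _; rewrite subr_gt0 expr_lt1n. Qed.

Lemma sum_geo_le (x : R) N : 0 <= x -> x < 1 -> \sum_(j < N) x ^+ j <= (1 - x)^-1.
Proof.
move=> x0 x1; rewrite sum_geo ?lt_eqF //; apply: ler_piMl; last by rewrite gerBl exprn_ge0.
by rewrite invr_ge0 subr_ge0 ltW.
Qed.

(** Each factor satisfies 1 / (1 - r^(n+1)) <= 1 + r^n / (1 - r) <= exp (r^n / (1 - r)); the
    exponents add up to a geometric sum, bounded independently of [m]. *)
Lemma qpoch_inv_le m : (qpoch r m)^-1 <= expR ((1 - r)^-1 / (1 - r)).
Proof.
have d0 : 0 < 1 - r by rewrite subr_gt0.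
have H n : (qpoch r n)^-1 <= expR ((\sum_(i < n) r ^+ i) / (1 - r)).
  elim: n => [|n IH]; first by rewrite qpochE !big_ord0 mul0r expR0 invr1.
  rewrite qpochE !big_ord_recr -qpochE /= invfM mulrDl expRD.
  have dn : 0 < 1 - r ^+ n.+1 by rewrite subr_gt0 expr_lt1n.
  apply: ler_pM; rewrite ?invr_ge0 ?(ltW dn) ?(ltW (qpoch_gt0 _)) //.
  apply: le_trans (expR_ge1Dx _).
  rewrite -[X in X <= _]mul1r ler_pdivrMr //.
  have -> : (1 + r ^+ n / (1 - r)) = (1 - r + r ^+ n) / (1 - r).
    by field; rewrite gt_eqF.
  rewrite mulrAC ler_pdivlMr // mul1r exprS.
  have p0 : 0 <= r ^+ n by apply: exprn_ge0.
  have p1 : r ^+ n <= 1 by apply: exprn_ile1 => //; apply: ltW.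
  (* The quantities in [h1] and [h2] add up to the difference of the two sides of the goal. *)
  have h1 : 0 <= r ^+ n * (r * (1 - r ^+ n)) by rewrite !mulr_ge0 // subr_ge0.
  have h2 : 0 <= r ^+ n * (1 - r) ^+ 2 by rewrite mulr_ge0 // exprn_ge0 // ltW.
  lra.
apply: le_trans (H m) _; rewrite ler_expR ler_pM2r ?invr_gt0 //.
exact: sum_geo_le.
Qed.

Lemma sum_nat_geo n : \sum_(m < n) m%:R * r ^+ m <= (1 - r)^-2.
Proof.
have d0 : 0 < 1 - r by rewrite subr_gt0.
(* The subtracted remainder makes the bound inductive: at each step the right side gains exactly
   [r ^+ n * (1 - r) ^+ 2] more than the left. *)
suff : (\sum_(m < n) m%:R * r ^+ m) * (1 - r) ^+ 2 <= 1 - r ^+ n * (1 + n%:R * (1 - r)).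
  rewrite -[_ ^- 2]mul1r ler_pdivlMr ?exprn_gt0 // => /le_trans; apply.
  by rewrite gerBl mulr_ge0 ?exprn_ge0 // addr_ge0 // mulr_ge0 // ltW.
elim: n => [|n IH]; first by rewrite big_ord0; lra.
rewrite big_ord_recr /= mulrDl (exprS r n) -natr1.
have p0 : 0 <= r ^+ n by apply: exprn_ge0.
have h : 0 <= r ^+ n * (1 - r) ^+ 2 by rewrite mulr_ge0 // exprn_ge0 // ltW.
lra.
Qed.

Lemma sum_term_le M : \sum_(1 <= m < M) term r m <=
   expR ((1 - r)^-1 / (1 - r)) * (1 - r)^-2.
Proof.
set E := expR _; have E0 : 0 <= E by apply: expR_ge0.
case: M => [|M]; first by rewrite big_geq // mulr_ge0 // invr_ge0 exprn_ge0 // subr_ge0 ltW.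
apply: (@le_trans _ _ (\sum_(1 <= m < M.+1) E * (m%:R * r ^+ m))).
  apply: ler_sum => m _; apply: ler_pM.
  - by rewrite invr_ge0 ltW // qpoch_gt0.
  - by apply: sumr_ge0 => i _; apply: exprn_ge0.
  - exact: qpoch_inv_le.
  rewrite big_mkord; apply: (@le_trans _ _ (\sum_(k < m) r ^+ m)).
    apply: ler_sum => k _; apply: ler_wiXn2l => //; first by apply: ltW.
    exact: leq_exponent.
  by rewrite sumr_const card_ord mulr_natl.
rewrite -mulr_sumr ler_wpM2l //; apply: le_trans (sum_nat_geo M.+1).
by rewrite -(big_mkord xpredT (fun m => m%:R * r ^+ m)) big_ltn // mul0r add0r.
Qed.

Lemma sum_box_le M N : \sum_(p <- box M N) r ^+ weight (val p) <=
   expR ((1 - r)^-1 / (1 - r)) * (1 - r)^-2.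
Proof.
apply: le_trans (sum_term_le M); rewrite sum_box; apply: ler_sum => m _.
apply: ler_wpM2r; first by apply: sumr_ge0 => i _; apply: exprn_ge0.
rewrite qpochE -prodfV; apply: ler_prod => i _; apply/andP; split.
  by apply: sumr_ge0 => j _; apply: exprn_ge0; apply: exprn_ge0.
by apply: sum_geo_le; [apply: exprn_ge0|apply: expr_lt1n].
Qed.

(** Every finite set lies in a box and the summands are nonnegative, so the box bound carries
    over. *)
Lemma sum_fset_le (A : {fset {p : overpartition | GON p}}) :
  \sum_(p <- A) r ^+ weight (val p) <=
  expR ((1 - r)^-1 / (1 - r)) * (1 - r)^-2.
Proof.
have [M [N AB]] := seq_box A.
apply: le_trans (sum_box_le M N).
have Ab : {subset A <= box M N} by apply: AB.
rewrite -(perm_big _ (enum_box M N)) /=.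
have ABs : (A `<=` boxset M N)%fset.
  by apply/fsubsetP => p pA; rewrite mem_box Ab.
apply: (ler_sum_fset (F := fun p => r ^+ weight (val p)) ABs) => p.
exact: exprn_ge0.
Qed.

End Real.

(** * Limits of box sums as the increments become unbounded *)

Section NumField.
Context (K : numFieldType).

Lemma cvg_sum_geo (z : K) : z != 1 -> (fun n => z ^+ n) @ \oo --> (0 : K) ->
  (fun n => \sum_(j < n) z ^+ j) @ \oo --> (1 - z)^-1.
Proof.
move=> zn1 z0; under eq_fun do rewrite sum_geo //.
have h : (fun n => 1 - z ^+ n) @ \oo --> (1 - 0 : K).
  by apply: cvgB => //; exact: cvg_cst.
rewrite subr0 in h; have := cvgM h (cvg_cst (1 - z)^-1).
rewrite mul1r; exact.
Qed.

Lemma cvg_bigsum (I : Type) (s : seq I) (f : I -> nat -> K) (a : I -> K) :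
  (forall i, f i @ \oo --> a i) ->
  (fun n => \sum_(i <- s) f i n) @ \oo --> \sum_(i <- s) a i.
Proof. by move=> fa; apply: cvg_big => //; exact: add_continuous. Qed.

Lemma cvg_bigprod (I : Type) (s : seq I) (f : I -> nat -> K) (a : I -> K) :
  (forall i, f i @ \oo --> a i) ->
  (fun n => \prod_(i <- s) f i n) @ \oo --> \prod_(i <- s) a i.
Proof. by move=> fa; apply: cvg_big => //; exact: mul_continuous. Qed.

Lemma cvg_sum_box (q : K) M : `|q| < 1 ->
  (forall z : K, `|z| < 1 -> (fun n => z ^+ n) @ \oo --> (0 : K)) ->
  (fun N => \sum_(p <- box M N) q ^+ weight (val p)) @ \oo -->
    \sum_(1 <= m < M) term q m.
Proof.
move=> q1 H; under eq_fun do rewrite sum_box.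
apply: cvg_bigsum => m.
apply: cvgM; last exact: cvg_cst.
rewrite qpochE -prodfV.
apply: cvg_bigprod => i.
have qi : `|q ^+ i.+1| < 1 by rewrite normrX exprn_ilt1.
apply: cvg_sum_geo; last exact: H.
by apply: contraTneq qi => ->; rewrite normr1 ltxx.
Qed.

End NumField.

(** * Complex limits and unconditional summability *)

Section Complex.
Context (R : realType).
Local Notation C := (Cplx R).
Definition toC (x : R) : C := real_complex R x.
HB.instance Definition _ := GRing.RMorphism.copy toC (real_complex R).

Lemma toC_lt x y : (toC x < toC y) = (x < y).
Proof. exact: ltcR. Qed.
Lemma toC_le x y : (toC x <= toC y) = (x <= y).
Proof. exact: lecR. Qed.

(** Lets the epsilon of a complex limit, itself an element of [C], be taken in [R]. *)
Lemma toC_gt0 (e : C) : 0 < e -> exists2 x : R, 0 < x & e = toC x.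
Proof.
move=> e0; have := e0; rewrite ltcE => /andP[/eqP ei er].
exists (complex.Re e) => //.
by rewrite /toC RRe_real // ger0_real // ltW.
Qed.

Lemma normC_ge0 (z : C) : exists2 x : R, 0 <= x & `|z| = toC x.
Proof.
exists (complex.Re `|z|); last by rewrite /toC RRe_real ?normr_real.
by have := normr_ge0 z; rewrite lecE => /andP[].
Qed.

Lemma norm_toC x : `|toC x| = toC `|x|.
Proof.
by rewrite /toC normc_def /= expr0n addr0 sqrtr_sqr.
Qed.

Lemma cvg_toC (T : Type) (F : set_system T) {FF : Filter F} (u : T -> R) (a : R) :
  u x @[x --> F] --> a -> toC (u x) @[x --> F] --> toC a.
Proof.
move=> ua; apply/cvgrPdist_lt => _ /toC_gt0[e e0 ->].
move/cvgrPdist_lt: ua => /(_ e e0); apply: filterS => x.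
by rewrite -rmorphB norm_toC toC_lt.
Qed.

Lemma cvg_complex_norm0 (T : Type) (F : set_system T) {FF : Filter F} (u : T -> C) (v : T -> R) :
  (forall x, `|u x| = toC (v x)) ->
  v x @[x --> F] --> 0 -> u x @[x --> F] --> (0 : C).
Proof.
move=> uv v0; apply/cvgrPdist_lt => _ /toC_gt0[e e0 ->].
move/cvgrPdist_lt: v0 => /(_ e e0); apply: filterS => x.
rewrite !sub0r !normrN uv toC_lt; apply: le_lt_trans; exact: ler_norm.
Qed.

Lemma cvg_expC (z : C) : `|z| < 1 -> (fun n => z ^+ n) @ \oo --> (0 : C).
Proof.
have [r r0 E] := normC_ge0 z; rewrite E -[1](rmorph1 toC) toC_lt => r1.
apply: (@cvg_complex_norm0 _ _ _ _ (fun n => r ^+ n)).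
  by move=> n; rewrite normrX E rmorphXn.
by apply: cvg_expr; rewrite ger0_norm.
Qed.


(** Once a finite set nearly exhausts the supremum of the sums of [g], the remaining terms of [f]
    are negligible; it then suffices that arbitrarily large finite sets approximate [L]. *)
Lemma cvg_partial_sum (I : choiceType) (f : I -> C) (g : I -> R) (c : R) (L : C) :
  (forall i, `|f i| <= toC (g i)) ->
  (forall A : {fset I}, \sum_(i <- A) g i <= c) ->
  (forall (A : {fset I}) (e : C), 0 < e ->
    exists2 B : {fset I}, (A `<=` B)%fset & `|L - \sum_(i <- B) f i| < e) ->
  partial_sum f @ totally --> L.
Proof.
move=> fg gc fL; have FF := @totally_filter I; apply/cvgrPdist_lt => _ /toC_gt0[e e0 ->].
have g0 i : 0 <= g i by rewrite -toC_le (le_trans _ (fg i)) // normr_ge0.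
pose S := [set \sum_(i <- A) g i | A in [set: {fset I}]].
have hS : has_sup S.
  split; first by exists (\sum_(i <- fset0) g i); exists fset0.
  by exists c => _ [A _ <-].
have e2 : 0 < e / 2 by rewrite divr_gt0.
(* [A] leaves less than [e / 2] of the supremum. For [D] containing [B], half of [e] pays for [B]
   against [L], the other half for the terms of [D] outside [B]. *)
have [_ [A _ <-] Ae] := sup_adherent e2 hS.
have [B AB BL] : exists2 B : {fset I}, (A `<=` B)%fset & `|L - \sum_(i <- B) f i| < toC (e / 2).
  by apply: fL; rewrite -(rmorph0 toC) toC_lt.
exists B => // D /= BD; rewrite /partial_sum -(big_seq_fsetE _ _ xpredT).
rewrite (big_fsetDsub f BD) opprD addrA [e]splitr rmorphD.
apply: le_lt_trans (ler_normB _ _) _; apply: ltrD => //.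
apply: le_lt_trans (ler_norm_sum _ _ _) _.
apply: (@le_lt_trans _ _ (\sum_(i <- [fset x in D | x \notin B]%fset) toC (g i))).
  by apply: ler_sum.
rewrite -rmorph_sum toC_lt.
have D_le : \sum_(i <- D) g i <= sup S by apply: sup_upper_bound => //; exists D.
have := ler_sum_fset AB g0; rewrite (big_fsetDsub g BD) in D_le; lra.
Qed.

End Complex.

(** * Convergence of dominated series, real then complex *)

Section RealSeries.
Context (R : realType) (a : nat).

Lemma nneg_bounded_sum_cvg (v : nat -> R) (c : R) :
  (forall k, 0 <= v k) -> (forall n, \sum_(a <= k < n) v k <= c) ->
  cvg ((fun n => \sum_(a <= k < n) v k) @ \oo).
Proof.
move=> v0 vc; apply: nondecreasing_is_cvgn; last by exists c => _ [n _ <-].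
apply/nondecreasing_seqP => n; have [an|na] := leqP a n.
  by rewrite big_nat_recr //= lerDl.
by rewrite !big_geq // ltnW.
Qed.

(** Writing [w] as [(w + v) - v] gives a difference of two nonnegative series with bounded partial
    sums. *)
Lemma dominated_sum_cvg (w v : nat -> R) (c : R) :
  (forall k, `|w k| <= v k) -> (forall n, \sum_(a <= k < n) v k <= c) ->
  cvg ((fun n => \sum_(a <= k < n) w k) @ \oo).
Proof.
move=> wv vc; have v0 k : 0 <= v k by apply: le_trans (wv k).
have h1 := nneg_bounded_sum_cvg v0 vc.
have h2 : cvg ((fun n => \sum_(a <= k < n) (w k + v k)) @ \oo).
  apply: (@nneg_bounded_sum_cvg _ (c + c)) => [k|n].
    by have := wv k; rewrite ler_norml => /andP[]; lra.
  rewrite big_split /= lerD //; apply: le_trans (vc n); apply: ler_sum => k _.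
  exact: le_trans (ler_norm _) (wv k).
have -> : (fun n => \sum_(a <= k < n) w k) =
    (fun n => \sum_(a <= k < n) (w k + v k) - \sum_(a <= k < n) v k).
  by apply/funext => n; rewrite -sumrB; apply: eq_bigr => k _; rewrite addrK.
exact: is_cvgB.
Qed.
End RealSeries.

Section ComplexSeries.
Context (R : realType).
Local Notation C := (Cplx R).

Lemma is_cvg_ReIm (u : nat -> C) :
  cvg ((fun n => complex.Re (u n)) @ \oo) -> cvg ((fun n => complex.Im (u n)) @ \oo) ->
  cvg (u @ \oo).
Proof.
move=> /cvg_toC hr /cvg_toC hi.
have -> : u = (fun n => toC (complex.Re (u n)) + ('i%C : C) * toC (complex.Im (u n))).
  by apply/funext => n; rewrite {1}(complexE (u n)).
apply: is_cvgD; first exact: (cvgP _ hr).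
apply: is_cvgM; first exact: is_cvg_cst.
exact: (cvgP _ hi).
Qed.

Lemma norm_Im_le (z : C) : toC `|complex.Im z| <= `|z|.
Proof.
by rewrite normc_def toC_le -sqrtr_sqr; apply: ler_wsqrtr; rewrite lerDr sqr_ge0.
Qed.

Lemma dominated_sum_cvgC (a : nat) (u : nat -> C) (v : nat -> R) (c : R) :
  (forall k, `|u k| <= toC (v k)) -> (forall n, \sum_(a <= k < n) v k <= c) ->
  cvg ((fun n => \sum_(a <= k < n) u k) @ \oo).
Proof.
move=> uv vc; apply: is_cvg_ReIm.
  under eq_fun do rewrite (raddf_sum (@complex.Re R : Rcomplex R -> R)).
  apply: (dominated_sum_cvg _ vc) => k; rewrite -toC_le.
  exact: le_trans (normc_ge_Re _) (uv k).
under eq_fun do rewrite (raddf_sum (@complex.Im R : Rcomplex R -> R)).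
apply: (dominated_sum_cvg _ vc) => k; rewrite -toC_le.
exact: le_trans (norm_Im_le _) (uv k).
Qed.

(** The reverse triangle inequality bounds each factor |1 - q^i| below by 1 - r^i > 0; the inner sum
    uses the triangle inequality. *)
Lemma norm_term (q : C) (r : R) m : 0 <= r -> r < 1 -> `|q| = toC r ->
  `|term q m| <= toC (term r m).
Proof.
move=> r0 r1 qr; rewrite /term normrM rmorphM /=.
apply: ler_pM => //.
  rewrite !qpochE -!prodfV normr_prod rmorph_prod /=; apply: ler_prod => i _.
  have pos : 0 < toC (1 - r ^+ i.+1).
    by rewrite -(rmorph0 (@toC R)) toC_lt subr_gt0 expr_lt1n.
  have le : toC (1 - r ^+ i.+1) <= `|1 - q ^+ i.+1|.
    have -> : toC (1 - r ^+ i.+1) = `|1 : C| - `|q ^+ i.+1|.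
      by rewrite rmorphB rmorph1 rmorphXn normr1 normrX qr.
    exact: lerB_dist.
  by rewrite normr_ge0 normfV fmorphV lef_pV2 ?posrE // (lt_le_trans pos le).
apply: le_trans (ler_norm_sum _ _ _) _; rewrite rmorph_sum /=.
by apply: ler_sum => k _; rewrite normrX qr rmorphXn.
Qed.
End ComplexSeries.

(* The subtraction in the exponent is exact: 'C(k.+1, 2) <= k.+1 * m for k < m. *)
Theorem mainTheorem7 (R : realType) (q : Cplx R) (hq : `|q| < 1) :
  let lhs (p : {p : overpartition | GON p}) : Cplx R :=
    q ^+ weight (val p) in
  let rhs (m : nat) : Cplx R :=
    (qpoch q m)^-1 * \sum_(0 <= k < m) q ^+ (k.+1 * m - 'C(k.+1, 2)) in
  [/\ cvg (partial_sum lhs @ totally),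
      cvg ((fun n => \sum_(1 <= m < n) rhs m) @ \oo)
    & summability.sum lhs = \big[+%R/0]_(1 <= m <oo) rhs m].
Proof.
move=> lhs rhs; have [r r0 qr] := normC_ge0 q.
have r1 : r < 1 by rewrite -toC_lt -qr rmorph1.
have cv : cvg ((fun n => \sum_(1 <= m < n) rhs m) @ \oo).
  exact: dominated_sum_cvgC (fun m => norm_term m r0 r1 qr) (sum_term_le r0 r1).
have H : partial_sum lhs @ totally --> \big[+%R/0]_(1 <= m <oo) rhs m.
  apply: (cvg_partial_sum (g := fun p => r ^+ weight (val p)) _ (sum_fset_le r0 r1)).
    by move=> p; rewrite /lhs normrX qr rmorphXn.
  (* [M2] is fixed first, bringing the partial sum near the series; [N2] then depends on [M2] and
     brings the box sum near that partial sum. Both exceed the thresholds beyond which boxes contain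
     [A]. *)
  move=> A e e0; have [M [N AB]] := seq_box A.
  have e2 : 0 < e / 2 by rewrite divr_gt0.
  have := cv => /cvgrPdist_lt /(_ _ e2) [M1 _ HM].
  set M2 := maxn M M1; have := HM M2 (leq_maxr _ _) => /= {}HM.
  have := @cvg_sum_box (Cplx R) q M2 hq (@cvg_expC R) => /cvgrPdist_lt /(_ _ e2) [N1 _ HN].
  set N2 := maxn N N1; have := HN N2 (leq_maxr _ _) => /= {}HN.
  exists (boxset M2 N2).
    by apply/fsubsetP => p pA; rewrite mem_box (AB _ _ _ _ p pA) // leq_maxl.
  rewrite (perm_big _ (enum_box M2 N2)) /= [e]splitr.
  have -> : \big[+%R/0]_(1 <= m <oo) rhs m - \sum_(i <- box M2 N2) lhs i =
    (\big[+%R/0]_(1 <= m <oo) rhs m - \sum_(1 <= m < M2) rhs m) +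
    (\sum_(1 <= m < M2) rhs m - \sum_(i <- box M2 N2) lhs i).
    by rewrite addrA subrK.
  by apply: le_lt_trans (ler_normD _ _) _; apply: ltrD.
have FF := @totally_filter {p : overpartition | GON p}.
split; [exact: cvgP H | exact: cv |].
rewrite /summability.sum.
apply: (@cvg_lim _ (@norm_hausdorff _ (Cplx R)) _ _ FF _ _ H).
Qed.
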